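(* For any $n\in\mathbb{Z}$ with $n\geq 4$, $h(\mathrm{SD}_{2^n})=2^{2(n-2)}=|\mathrm{SD}_{2^n}'|^2$.
   Context: For a finite group $G$ with conjugacy classes $K_1,\dots,K_s$ and irreducible complex characters $\chi_1,\dots,\chi_s$, Harada's number is $h(G)=\frac{|K_1|\cdots|K_s|}{\chi_1(1)\cdots\chi_s(1)}$. $G'$ denotes the commutator subgroup of $G$. For $n\ge 4$ the semi-dihedral group is $\mathrm{SD}_{2^n}=\langle\sigma,\tau\mid\sigma^{2^{n-1}}=\tau^2=1,\ \sigma^\tau=\sigma^{2^{n-2}-1}\rangle$, where $y^x=x^{-1}yx$. *)

(* Defs.v *)
From mathcomp Require Import all_boot all_order all_algebra all_fingroup.
From mathcomp Require Import all_solvable all_field all_character.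

Set Implicit Arguments.
Unset Strict Implicit.
Unset Printing Implicit Defensive.

Import GRing.Theory.
Local Open Scope ring_scope.

(* The value lies in algC because the character degrees 'chi_i 1%g do. *)
Definition harada (gT : finGroupType) (G : {group gT}) : algC :=
  (\prod_(K in classes G) #|K|%:R) / (\prod_(i : Iirr G) 'chi_i 1%g).

(* For n > 3, 'SD_(2 ^ n) is the group with presentation
   < x, y | x^(2^(n-1)) = y^2 = 1, x^y = x^(2^(n-2) - 1) >,
   as proved in Grp_semidihedral (solvable/extremal.v); here x ^ y is
   y^-1 * x * y. For other n the notation is not meaningful. *)

(* Main.v *)
Require Import Defs.
From mathcomp Require Import all_boot all_order all_algebra all_fingroup.
From mathcomp Require Import all_solvable all_field all_character.
From mathcomp Require Import zify.

(** Let G be semidihedral of order 4r, with r = 2^(n-2). Its cyclic subgroup X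
    of order 2r is abelian of index 2, so the character degrees and the sizes
    of the classes inside X are all 1 or 2:
    - an irreducible character of G lies over a linear character of X, so its
      degree is 1 or 2; the sum of the squared degrees being #|G|, there are
      (#|G| - #|G : G'|) / 4 = r - 1 factors 2 ([prod_irr1_index2]);
    - the centraliser of an element of X contains X, so a class inside X has
      one element if it is central and two otherwise; as the center lies in X
      and has order 2, there are (2r - 2) / 2 = r - 1 classes of size 2
      ([prod_card_class_index2]).
    These two powers of 2 cancel in the quotient. What remains is the
    contribution of the complement of X, which has 2r elements and splits into
    two classes. No class is larger than G' ([card_class_leq_der1]), which has
    order r; hence both have exactly r elements and h(G) = r^2 = #|G'|^2. *)

Import Order.TTheory GRing.Theory Num.Theory.
Local Open Scope ring_scope.

Section HaradaNumber.

Set Implicit Arguments.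
Unset Strict Implicit.
Import GroupScope.

Lemma sum_card_class_normal (gT : finGroupType) (G N : {group gT}) :
  N <| G -> (\sum_(K in classes G | K \subset N) #|K|)%N = #|N|.
Proof.
move=> /andP[sNG nNG]; have /and3P[_ tiG nt0] := classes_partition G.
suff pN : partition (classes G ::&: N) N.
  by rewrite (card_partition pN); apply: eq_bigl => K; rewrite inE.
apply/and3P; split; last by rewrite inE negb_and nt0.
  rewrite eqEsubset; apply/andP; split.
    by apply/bigcupsP => K /setIdP[].
  apply/subsetP => z Nz; apply/bigcupP; exists (z ^: G); last exact: class_refl.
  have Gz := subsetP sNG z Nz.
  by rewrite inE mem_classes ?class_sub_norm.
by apply: (trivIsetS _ tiG); apply/subsetP => K /setIdP[].
Qed.

Lemma class_in_abelian_index2 (gT : finGroupType) (G A : {group gT}) x :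
    abelian A -> A \subset G -> #|G : A| = 2%N -> x \in A :\: 'Z(G) ->
  #|x ^: G| = 2%N.
Proof.
move=> abA sAG iAG /setDP[Ax notZx]; have Gx := subsetP sAG x Ax.
have sAC : A \subset 'C_G[x].
  by rewrite subsetI sAG sub_cent1 (subsetP abA).
rewrite -index_cent1; apply/prime_nt_dvdP => //.
  rewrite indexg_eq1 subsetI subxx /=; apply: contra notZx.
  by rewrite sub_cent1 => cGx; rewrite inE Gx.
by rewrite -iAG -(Lagrange_index (subsetIl G _) sAC) dvdn_mulr.
Qed.

(** The centraliser in [G] of an element of [A] is [A] or [G], so the classes
    inside [A] have size 2 or 1; counting the elements of [A] outside the center
    then gives the number of 2's without enumerating these classes. *)
Lemma prod_card_class_index2 (gT : finGroupType) (G A : {group gT}) :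
    abelian A -> A \subset G -> #|G : A| = 2%N -> 'Z(G) \subset A ->
  exists2 l, #|A| = (#|'Z(G)| + 2 * l)%N &
    (\prod_(K in classes G) #|K|)%N =
      (2 ^ l * \prod_(K in classes G | ~~ (K \subset A)) #|K|)%N.
Proof.
move=> abA sAG iAG sZA; have nsAG := index2_normal sAG iAG.
pose P := [pred K | (K \in classes G) && (K \subset A)].
have size2 K : P K && ~~ (K \subset 'Z(G)) -> #|K| = 2%N.
  case/andP=> /andP[/imsetP[x Gx ->]].
  rewrite !class_sub_norm ?gFnorm ?normal_norm // => Ax notZx.
  by apply: (class_in_abelian_index2 abA sAG iAG); rewrite inE notZx.
exists #|[pred K | P K & ~~ (K \subset 'Z(G))]|.
  rewrite -(sum_card_class_normal nsAG).
  rewrite (bigID [pred K : {set gT} | K \subset 'Z(G)]) /=; congr (_ + _)%N.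
    rewrite -(sum_card_class_normal (center_normal G)).
    apply: eq_bigl => K; rewrite -andbA; congr (_ && _).
    by apply: andb_idl => /subset_trans->.
  by rewrite mulnC -sum_nat_const; apply: eq_bigr => K /size2.
rewrite (bigID [pred K : {set gT} | K \subset A]) /=; congr (_ * _)%N.
rewrite (bigID [pred K : {set gT} | K \subset 'Z(G)]) /= big1 ?mul1n.
  by rewrite -prod_nat_const; apply: eq_bigr => K /size2.
move=> _ /andP[/andP[/imsetP[x Gx ->] _]].
rewrite class_sub_norm ?gFnorm // => /centerP[_ cGx]; rewrite -index_cent1.
apply/eqP; rewrite indexg_eq1 subsetI subxx sub_cent1 /=.
by apply/centP=> z Gz; apply: cGx.
Qed.

(** Since [x ^ t = x * [~ x, t]], the class of [x] lies in one coset of the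
    derived subgroup. *)
Lemma card_class_leq_der1 (gT : finGroupType) (G : {group gT}) x :
  x \in G -> (#|x ^: G| <= #|G^`(1)|)%N.
Proof.
move=> Gx; rewrite -(card_lcoset G^`(1) x); apply/subset_leq_card/subsetP => z.
by case/imsetP=> t Gt ->; rewrite mem_lcoset -commgEl mem_commg.
Qed.

(** By Frobenius reciprocity ['chi_i] is a constituent of the character induced
    from a constituent of its restriction to [A], which is linear. *)
Lemma irr1_leq_index_abelian (gT : finGroupType) (G A : {group gT}) (i : Iirr G) :
  abelian A -> A \subset G -> 'chi_i 1 <= #|G : A|%:R.
Proof.
move=> abA sAG; have Nchi := irr_char i.
have /neq0_has_constt[j jRes] : 'Res[A] 'chi_i != 0.
  by rewrite cfRes_eq0 // irr_neq0.
rewrite -constt_Ind_Res in jRes.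
have Nind : 'Ind[G] 'chi_j \is a character by rewrite cfInd_char ?irr_char.
apply: le_trans (char1_ge_constt Nind jRes) _.
have /char_abelianP linA := abA.
by rewrite cfInd1 // lin_char1 ?mulr1.
Qed.

Lemma irr1_index2 (gT : finGroupType) (G A : {group gT}) (i : Iirr G) :
    abelian A -> A \subset G -> #|G : A| = 2%N ->
  'chi_i 1 = (if 'chi_i \is a linear_char then 1 else 2)%N%:R%R.
Proof.
move=> abA sAG iAG; case: ifP => [/lin_char1 //|].
rewrite qualifE /= irr_char /= irr1_degree pnatr_eq1 => /negbT.
have := irr1_leq_index_abelian i abA sAG; have := irr1_gt0 i.
rewrite iAG irr1_degree ler_nat ltr0n.
by case: (irr_degree _) => [|[|[|]]].
Qed.

(** The sum of the squared degrees determines the number of degrees equal to 2,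
    so no irreducible character has to be constructed. *)
Lemma prod_irr1_index2 (gT : finGroupType) (G A : {group gT}) :
    abelian A -> A \subset G -> #|G : A| = 2%N ->
  exists2 k, #|G| = (#|G : G^`(1)| + 4 * k)%N &
    (\prod_(i : Iirr G) 'chi_i 1%g = (2 ^ k)%N%:R)%R.
Proof.
move=> abA sAG iAG; pose lin := [pred i : Iirr G | 'chi_i \is a linear_char].
exists #|[pred i | ~~ lin i]|.
  apply/eqP; rewrite -(eqr_nat algC) -irr_sum_square natrD -card_lin_irr.
  rewrite (bigID lin) /= -sum1_card natr_sum; apply/eqP; congr (_ + _).
    by apply: eq_bigr => i /lin_char1->; rewrite expr1n.
  rewrite mulnC -sum_nat_const natr_sum; apply: eq_bigr => i /negPf notlin.
  by rewrite (irr1_index2 _ abA sAG iAG) notlin -natrX.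
rewrite (bigID lin) /= big1 => [|i /lin_char1 //]; rewrite mul1r natrX.
rewrite -prodr_const; apply: eq_bigr => i /negPf notlin.
by rewrite (irr1_index2 _ abA sAG iAG) notlin.
Qed.

Lemma harada_semidihedral (gT : finGroupType) (G : {group gT}) n :
  (n > 3)%N -> G \isog 'SD_(2 ^ n) -> harada G = (#|G^`(1)%g| ^ 2)%N%:R%R.
Proof.
move=> hn isoG.
have [[x y] genG [oy _]] := generators_semidihedral hn isoG.
have [oG Gx ox /setDP[Gy X'y]] := genG.
have [_ [_ _ oG' _] [defZ oZ _ _] [[defGX tiyG] _] _] :=
  semidihedral_structure hn genG isoG oy.
pose X := <[x]>%G; pose r := (2 ^ n.-2)%N.
pose yG := y ^: G; pose xyG := (x * y) ^: G.
rewrite -/yG -/xyG in defGX tiyG.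
have sXG : X \subset G by rewrite cycle_subG.
have abX : abelian X by apply: cycle_abelian.
have oX : #|X| = (2 * r)%N by rewrite -orderE ox -expnS; congr (2 ^ _)%N; lia.
have oG2 : #|G| = (2 * (2 * r))%N by rewrite oG -!expnS; congr (2 ^ _)%N; lia.
have r_gt0 : (0 < r)%N by rewrite expn_gt0.
have iXG : #|G : X| = 2%N by rewrite -divgS // oG2 oX mulnK // muln_gt0.
have iG' : #|G : G^`(1)| = 4%N.
  by rewrite -divgS ?der_sub // oG' oG2 mulnA mulnK.
have sZX : 'Z(G) \subset X by rewrite defZ cycleX.
have Gxy : x * y \in G by rewrite groupM.
(* The two classes have 2r elements together and at most r each. *)
have [oyG oxyG] : #|yG| = r /\ #|xyG| = r.
  have := card_class_leq_der1 Gy; have := card_class_leq_der1 Gxy.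
  have : (#|yG| + #|xyG|)%N = (2 * r)%N.
    rewrite -cardsUI; have /disjoint_setI0-> := tiyG.
    rewrite defGX cards0 addn0 cardsD (setIidPr sXG) oG2 oX; lia.
  rewrite oG' -/r -/yG -/xyG; lia.
have prod_out : (\prod_(K in classes G | ~~ (K \subset X)) #|K|)%N = (r * r)%N.
  have nXG : G \subset 'N(X) by apply/normal_norm/index2_normal.
  have neq_class : yG != xyG.
    apply: contraTneq tiyG => <-; rewrite -setI_eq0 setIid -cards_eq0 oyG; lia.
  have outE : (fun K => (K \in classes G) && ~~ (K \subset X))
                =1 [in [set yG; xyG]].
    move=> K; rewrite !inE; apply/andP/orP.
      case=> /imsetP[z Gz ->]; rewrite class_sub_norm // => X'z.
      have : z \in yG :|: xyG by rewrite defGX inE X'z.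
      by case/setUP=> /class_eqP->; [left | right].
    have X'xy : x * y \notin X by rewrite groupMl ?cycle_id.
    by case=> /eqP->; rewrite class_sub_norm // mem_classes.
  by rewrite (eq_bigl _ _ outE) big_setU1 ?inE //= big_set1 oyG oxyG.
have [l oXl prodK] := prod_card_class_index2 abX sXG iXG sZX.
have [k oGk prodI] := prod_irr1_index2 abX sXG iXG.
have eq_kl : k = l by move: oXl oGk; rewrite oX oG2 iG' oZ; lia.
rewrite /harada prodI -natr_prod prodK prod_out eq_kl natrM mulrAC divff ?mul1r.
  by rewrite oG'.
by rewrite pnatr_eq0 expn_eq0.
Qed.

End HaradaNumber.

Theorem proposition4p9 (n : nat) (hn : (4 <= n)%N) :
  harada ('SD_(2 ^ n))%G = (2 ^ (2 * (n - 2)))%:R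
  /\ (2 ^ (2 * (n - 2)))%N = (#|(('SD_(2 ^ n))^`(1))%g| ^ 2)%N.
Proof.
pose G := ('SD_(2 ^ n))%G; have isoG : (G \isog 'SD_(2 ^ n))%g := isog_refl G.
have [[x y] genG [oy _]] := generators_semidihedral hn isoG.
have [_ [_ _ oG' _] _ _ _] := semidihedral_structure hn genG isoG oy.
by rewrite (harada_semidihedral hn isoG) oG' mulnC expnM subn2.
Qed.
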